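(* Let $p\in(0,1)$, $q=1-p$, and let $X_n$ be the number of correct guesses under the optimal strategy in the complete feedback game after one asymmetric single-shelf shuffle of $n$ cards with parameter $p$. Let $\nu=1$ if $p\ge\frac12$ and $\nu=\left\lfloor \frac{\log p}{\log(1-p)}\right\rfloor+1$ if $0<p<\frac12$. Then for all $n\ge 1$, \[ \mathbb{E}(X_n)=\begin{cases} qn+p, & 1\le n\le \nu,\\ (1-pq)n+2p-(\nu+1)p^2-q^\nu, & n\ge \nu+1, \end{cases} \] and the variance of $X_n$ is \[ \mathrm{Var}(X_n)=\begin{cases} (n-1)pq, & 1\le n\le \nu,\\ (\nu-1)pq+\bigl(1-2(\nu-1)p\bigr)q^\nu-q^{2\nu}, & n=\nu+1,\\ pq(1-3pq)\,n-2pq+(3\nu+5)p^2q^2+\bigl(1-2\nu p+2p^2\bigr)q^\nu-q^{2\nu}, & n\ge \nu+2. \end{cases} \]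
   Context: Asymmetric single-shelf shuffle with parameter $p\in(0,1)$: start with an ordered deck of $n$ cards labelled $1,\dots,n$ (card $1$ on top). Cards are drawn one at a time from the bottom of the deck (card $n$ first, card $1$ last) and placed in a pile; independently, each drawn card is placed at the top of the pile with probability $p$ and at the bottom with probability $1-p$. Equivalently, let $\varepsilon_1,\dots,\varepsilon_{n-1}$ be independent Bernoulli$(p)$ ($\varepsilon_j=1$ iff card $j$ is placed at the top); the shuffled deck read from the top consists of the cards $j\le n-1$ with $\varepsilon_j=1$ in increasing order, then card $n$, then the cards with $\varepsilon_j=0$ in decreasing order. Complete feedback game: the player guesses the cards of the shuffled deck sequentially from the top; after each guess the card is shown and removed. Optimal strategy used: let $j$ be the label of the last card shown ($j=0$ before the first guess). As long as neither card $n$ nor card $n-1$ has been shown: if $p\ge\frac12$, guess $j+1$; if $p<\frac12$, guess $n$ when $n-j\le\nu$ and guess $j+1$ when $n-j>\nu$. Once card $n$ or $n-1$ has been shown, guess the remaining cards in decreasing order. $X_n=X_n(p)$ denotes the number of correct guesses under this strategy. *)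

(* Defs.v *)
From HB Require Import structures.
From mathcomp Require Export all_boot all_order all_algebra.
From mathcomp Require Export all_classical all_reals all_analysis.

Set Implicit Arguments.
Unset Strict Implicit.
Unset Printing Implicit Defensive.

Import Order.TTheory GRing.Theory Num.Theory.

Local Open Scope ring_scope.

(* Mutual independence: the product rule over every subfamily. *)
Definition mutually_independent (d d' : measure_display)
    (T : measurableType d) (T' : measurableType d') (R : realType)
    (P : probability T R) (I : finType) (X : I -> {RV P >-> T'}) : Prop :=
  forall (J : {set I}) (B : I -> set T'), (forall i, measurable (B i)) ->
    P (\bigcap_(i in [set` J]) (X i @^-1` B i))%classic =
    (\prod_(i in J) P (X i @^-1` B i)%classic)%E.

(* Decks, piles and histories are sequences of labels, top card first.  The
   coin of card j (1 <= j <= n - 1) is e i for the ordinal i with j = i.+1, and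
   true means "to the top".  Card n, drawn first, needs no coin. *)
Definition shuffle (n : nat) (e : 'I_n.-1 -> bool) : seq nat :=
  foldl (fun pile (i : 'I_n.-1) =>
           if e i then i.+1 :: pile else rcons pile i.+1)
        [:: n] (rev (enum 'I_n.-1)).

Lemma shuffleE (n : nat) (e : 'I_n.-1 -> bool) :
  shuffle e = [seq (i : 'I_n.-1).+1 | i <- enum 'I_n.-1 & e i] ++
              n :: rev [seq (i : 'I_n.-1).+1 | i <- enum 'I_n.-1 & ~~ e i].
Proof.
rewrite /shuffle foldl_rev; elim: (enum _) => [|i s IHs] //=.
rewrite IHs; case: (e i) => //=.
by rewrite rev_cons rcons_cat rcons_cons.
Qed.

(* A strategy maps the cards shown so far, in order, to the next guess. *)
Definition correct_guesses (strategy : seq nat -> nat) (deck : seq nat) : nat :=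
  (\sum_(k < size deck) (strategy (take k deck) == nth 0 deck k))%N.

Section Strategy.
Variable R : realType.

(* For 0 < p < 1/2 the quotient is positive, so truncn is the floor. *)
Definition nu (p : R) : nat :=
  if 2^-1 <= p then 1%N else (Num.truncn (ln p / ln (1 - p))).+1.

Definition guess (p : R) (n : nat) (shown : seq nat) : nat :=
  let j := last 0%N shown in
  if (n \in shown) || (n.-1 \in shown) then
    (\max_(c <- iota 1 n | c \notin shown) c)%N
  else if 2^-1 <= p then j.+1
  else if (n - j <= nu p)%N then n else j.+1.

End Strategy.

(* X_n as a function of the outcome. *)
Definition nb_correct (d : measure_display) (T : measurableType d)
    (R : realType) (P : probability T R) (p : R) (n : nat)
    (eps : 'I_n.-1 -> {RV P >-> bool}) (w : T) : R :=
  (correct_guesses (guess p n) (shuffle (fun i => eps i w)))%:R.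

(* Main.v *)
Require Import Defs.
From mathcomp Require Import all_boot all_order all_algebra.
From mathcomp Require Import all_classical all_reals all_analysis.
From mathcomp Require Import ring zify.

(** The number of correct guesses is an explicit function of the coins
    e_1, ..., e_(n-1).  The cards appear in increasing order until card n, so
    every card up to the last one shown, j, has either been shown or lies below
    card n at a known place.  Hence:
    - every card with e_i = 0 is guessed correctly, since it comes after card n,
      when the remaining deck is known to be decreasing;
    - a card i with e_i = 1 is guessed correctly iff the card shown just before
      it is i - 1 (with j = 0 for i = 1) and the strategy did not bet on n,
      that is i <= n - v;
    - card n is guessed correctly iff some card among the last v cards before it
      was shown, or n <= v: from then on the strategy always bets on n.
    Writing e_0 = 1, for n > v the score is therefore
      #{i | e_i = 0} + #{i <= n - v | e_(i-1) = e_i = 1}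
        + [e_i = 1 for some i >= n - v].
    For p >= 1/2, to guess j + 1 is the case v = 1 of the rule for p < 1/2, so
    both ranges of p are treated at once, with any positive v.

    Reading the coins from card 1 to card n - 1 turns this sum into a
    recursion, [score], whose state is two bits: whether the card just read was
    shown, and whether the last card shown is within distance v of n.  The link
    with the game is [correct_guesses_score].  By independence the mean of a
    function of the coins is a weighted sum over bit tuples
    ([expectation_coins]) that can be conditioned on the first coin
    ([coin_meanS]), so the first two moments of the score satisfy linear
    recursions in the number of coins left.  These are solved in closed form in
    three stages: fewer than v coins left ([score_moments_close] and
    [score_moments_last]), exactly v coins left ([score_moments_turn]), and
    more ([score_mean_far] and [score_mean_sqr_far]). *)

Set Implicit Arguments.
Unset Strict Implicit.
Unset Printing Implicit Defensive.

Import Order.TTheory GRing.Theory Num.Theory.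

Local Open Scope ring_scope.

(** * Shuffled deck and game as recursions over the coins *)

(** The deck that remains when the coins [c] of the cards after [j] are still
    unread and [skipped] lists the cards up to [j] already known to lie below
    the highest card, which is the one reached when the coins run out. *)
Fixpoint deal (j : nat) (c : seq bool) (skipped : seq nat) : seq nat :=
  match c with
  | [::] => j.+1 :: skipped
  | true :: c' => j.+1 :: deal j.+1 c' skipped
  | false :: c' => deal j.+1 c' (j.+1 :: skipped)
  end.

Lemma dealE (N : nat) (e : 'I_N -> bool) (s : seq 'I_N) (j : nat) skipped :
  [seq val i | i <- s] = iota j (size s) ->
  deal j [seq e i | i <- s] skipped =
    [seq (i : 'I_N).+1 | i <- s & e i] ++
    (j + size s).+1 :: rev [seq (i : 'I_N).+1 | i <- s & ~~ e i] ++ skipped.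
Proof.
elim: s j skipped => [|i s IHs] j sk /=; first by rewrite addn0.
move=> [ij /IHs {}IHs]; rewrite addnS -addSn.
by case: (e i) => /=; rewrite IHs -ij // rev_cons cat_rcons.
Qed.

Lemma shuffle_deal (n : nat) (e : 'I_n.-1 -> bool) : (0 < n)%N ->
  shuffle e = deal 0 [seq e i | i <- enum 'I_n.-1] [::].
Proof.
move=> n0; rewrite shuffleE dealE ?size_enum_ord ?val_enum_ord //.
by rewrite cats0 add0n prednK.
Qed.

Fixpoint hits (strategy : seq nat -> nat) (shown deck : seq nat) : nat :=
  if deck is x :: deck' then
    ((strategy shown == x) + hits strategy (rcons shown x) deck')%N
  else 0%N.

Lemma correct_guesses_hits strategy deck :
  correct_guesses strategy deck = hits strategy [::] deck.
Proof.
suff gen shown : (\sum_(k < size deck)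
    (strategy (shown ++ take k deck) == nth 0 deck k))%N =
    hits strategy shown deck by exact: (gen [::]).
elim: deck shown => [|x deck IH] shown; first by rewrite big_ord0.
rewrite big_ord_recl /= cats0 -IH; congr (_ + _)%N.
by apply: eq_bigr => k _; rewrite cat_rcons.
Qed.

Lemma gtn_trans : transitive gtn.
Proof. by move=> y x z /= yx zy; exact: ltn_trans zy yx. Qed.

(** In the final phase the strategy names the top of a decreasing deck. *)
Lemma max_unseen (n x : nat) (shown s : seq nat) :
  sorted gtn (x :: s) ->
  (forall y, (y \in x :: s) = (0 < y <= n)%N && (y \notin shown)) ->
  (\max_(c <- iota 1 n | c \notin shown) c)%N = x.
Proof.
move=> xs memE; apply/eqP; rewrite eqn_leq; apply/andP; split.
  apply/bigmax_leqP_seq => y; rewrite mem_iota add1n ltnS => yn yshown.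
  have := memE y; rewrite yn yshown inE => /orP[/eqP -> //|ys].
  have := order_path_min gtn_trans xs.
  by move/allP/(_ _ ys)/ltnW.
have := memE x; rewrite mem_head => /esym/andP[xn xshown].
by apply: leq_bigmax_seq => //; rewrite mem_iota add1n ltnS.
Qed.

Lemma hits_decreasing (R : realType) (p : R) (n : nat) (shown deck : seq nat) :
  (n \in shown) || (n.-1 \in shown) -> sorted gtn deck ->
  (forall y, (y \in deck) = (0 < y <= n)%N && (y \notin shown)) ->
  hits (guess p n) shown deck = size deck.
Proof.
elim: deck shown => [//|x deck IH] shown fin srt memE /=.
rewrite /guess fin (max_unseen srt memE) eqxx add1n IH ?(path_sorted srt) //.
  by rewrite !mem_rcons !inE; case/orP: fin => ->; rewrite !orbT.
move=> y; rewrite mem_rcons inE negb_or andbCA -memE inE.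
case: eqP => //= ->; apply/negP => xdeck.
have := order_path_min gtn_trans srt.
by move/allP/(_ _ xdeck); rewrite /= ltnn.
Qed.

(** The correct guesses still to come, cards already skipped excluded, when the
    coins [c] are those of the cards after [j]: [fresh] says that [j] itself is
    the last card shown, and [close] that the last card shown is within [v] of
    card n, so that the strategy bets on n.  With [c] of size [s] the next card
    is n - s, whence the comparisons of [v] with [s].  A skipped card scores its
    point at once, although it is guessed after card n. *)
Fixpoint score (v : nat) (fresh close : bool) (c : seq bool) : nat :=
  match c with
  | [::] => close
  | true :: c' =>
      ((fresh && (v <= (size c').+1)) + score v true ((size c').+1 <= v) c')%N
  | false :: c' => (1 + score v false close c')%N
  end.

Section Game.
Variables (R : realType) (p : R).

Lemma nu_gt0 : (0 < nu p)%N.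
Proof. by rewrite /nu; case: ifP. Qed.

(** One rule covers both ranges of p: when p >= 1/2, nu is 1, and betting on n
    at distance 1 is the same as betting on the successor. *)
Lemma guess_undecided (n : nat) (shown : seq nat) :
  n \notin shown -> n.-1 \notin shown ->
  (last 0%N shown < n)%N ->
  guess p n shown = if (n - last 0%N shown <= nu p)%N then n
                    else (last 0%N shown).+1.
Proof.
move=> nS n1S; rewrite /guess /nu (negbTE nS) (negbTE n1S) /=.
case: (2^-1 <= p) => // jn; case: leqP => // jn'; lia.
Qed.

(** Induction on the coins unread.  The invariants say that the history is
    bounded by its last card and that the cards up to [j] not in it are exactly
    those skipped, so that as soon as card n appears the rest of the deck is
    [skipped], which the strategy guesses without error. *)
Lemma hits_deal (n j : nat) (c : seq bool) (shown skipped : seq nat) :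
  n = (j + size c).+1 ->
  {in shown, forall y, y <= last 0 shown}%N ->
  (last 0 shown <= j)%N ->
  sorted gtn skipped ->
  (forall y, (y \in skipped) = (0 < y <= j)%N && (y \notin shown)) ->
  hits (guess p n) shown (deal j c skipped) =
    (size skipped +
     score (nu p) (last 0%N shown == j) (n - last 0 shown <= nu p) c)%N.
Proof.
elim: c j shown skipped => [|x c IH] j shown sk nE shown_le last_le srt memE.
  move: nE => /=; rewrite addn0 => nE.
  have srt' : sorted gtn (n :: sk).
    rewrite /= path_sortedE; last exact: gtn_trans.
    by rewrite srt andbT; apply/allP => y; rewrite memE /=; lia.
  have nS : n \notin shown by apply/negP => /shown_le; lia.
  rewrite -nE hits_decreasing ?mem_rcons ?mem_head //; first last.
    move=> y; rewrite memE mem_rcons inE negb_or andbA; congr andb; lia.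
  (* No coin left: card n is on top, and is guessed either because n - 1 was
     shown, which makes n the largest unseen card, or by the bet on n. *)
  rewrite addnC; congr (_ + nat_of_bool _)%N.
  case: (boolP (n.-1 \in shown)) => n1S.
    rewrite /guess n1S orbT (@max_unseen n n shown sk) ?eqxx //.
      by have := nu_gt0; have := shown_le _ n1S; lia.
    move=> y; rewrite inE memE; case: (eqVneq y n) => [->|yn] /=.
      by rewrite nS leqnn nE.
    by congr andb; lia.
  rewrite guess_undecided //; last lia.
  case: leqP => [|far]; rewrite ?eqxx //; have := nu_gt0; lia.
have jn : (j.+1 < n)%N by rewrite nE /=; lia.
have notin y : (j < y)%N -> y \notin shown.
  by move=> jy; apply/negP => /shown_le; lia.
have nE' : n = (j.+1 + size c).+1 by rewrite nE /=; lia.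
case: x {nE} => /=.
  (* Card j + 1 is shown next. *)
  have lastE : last 0%N (rcons shown j.+1) = j.+1 by rewrite last_rcons.
  rewrite (IH j.+1) ?lastE //; first last.
  - move=> y; rewrite memE mem_rcons inE negb_or andbA; congr andb; lia.
  - move=> y; rewrite mem_rcons inE => /orP[/eqP -> //|/shown_le]; lia.
  rewrite guess_undecided ?notin //; try lia.
  rewrite eqxx addnCA; congr (_ + (_ + score _ _ _ _))%N; last by lia.
  by congr nat_of_bool; case: (leqP (n - _) _) => far; lia.
(* Card j + 1 is skipped. *)
rewrite (IH j.+1) //=.
- rewrite addnS addSn addnC; congr (_.+1); rewrite addnC.
  by congr (_ + score _ _ _ _)%N; lia.
- lia.
- rewrite path_sortedE ?srt ?andbT; last exact: gtn_trans.
  by apply/allP => y; rewrite memE /=; lia.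
- move=> y; rewrite inE memE; case: (eqVneq y j.+1) => [->|yj] /=.
    by rewrite leqnn notin.
  by congr andb; lia.
Qed.

Lemma correct_guesses_score (n : nat) (e : 'I_n.-1 -> bool) : (0 < n)%N ->
  correct_guesses (guess p n) (shuffle e) =
  score (nu p) true (n <= nu p)%N [seq e i | i <- enum 'I_n.-1].
Proof.
move=> n0; rewrite correct_guesses_hits shuffle_deal // (@hits_deal n 0) //=.
- by rewrite add0n subn0.
- by rewrite size_map size_enum_ord add0n prednK.
- by move=> y; rewrite leqn0; case: y.
Qed.

End Game.

(** * Expectation over independent biased coins *)

Section CoinMean.
Variables (R : realType) (p : R).

Definition coin_mean (N : nat) (f : seq bool -> R) : R :=
  \sum_(t : N.-tuple bool) (\prod_(b <- t) bernoulli_pmf p b) * f t.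

(** Conditioning on the first coin. *)
Lemma coin_meanS (N : nat) (f : seq bool -> R) :
  coin_mean N.+1 f = p * coin_mean N (fun c => f (true :: c))
                     + (1 - p) * coin_mean N (fun c => f (false :: c)).
Proof.
pose F x (t : N.-tuple bool) :=
  (\prod_(b <- x :: t) bernoulli_pmf p b) * f (x :: t).
have -> : coin_mean N.+1 f = \sum_x \sum_t F x t.
  rewrite pair_bigA /=.
  apply: (@reindex _ _ _ _ _
    (fun u : bool * N.-tuple bool => cons_tuple u.1 u.2)).
  exists (fun t : N.+1.-tuple bool => (thead t, behead_tuple t)).
    by move=> [x t] _ /=; congr pair; exact: val_inj.
  by move=> t _ /=; rewrite [RHS]tuple_eta.
rewrite big_bool !mulr_sumr; congr (_ + _); apply: eq_bigr => t _.
  by rewrite /F big_cons mulrA.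
by rewrite /F big_cons mulrA.
Qed.

Lemma coin_mean0 (f : seq bool -> R) : coin_mean 0 f = f [::].
Proof.
rewrite /coin_mean (big_pred1 [tuple]) ?big_nil ?mul1r // => t.
by apply/esym/eqP; exact: tuple0.
Qed.

Lemma eq_coin_mean (N : nat) (f g : seq bool -> R) :
  (forall c, size c = N -> f c = g c) -> coin_mean N f = coin_mean N g.
Proof. by move=> fg; apply: eq_bigr => t _; rewrite fg ?size_tuple. Qed.

Lemma coin_mean_shift (N : nat) (k : R) (f : seq bool -> R) :
  coin_mean N (fun c => k + f c) = k + coin_mean N f.
Proof.
elim: N f => [|N IH] f; first by rewrite !coin_mean0.
by rewrite !coin_meanS !IH; ring.
Qed.

Lemma coin_mean_sqr_shift (N : nat) (k : R) (f : seq bool -> R) :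
  coin_mean N (fun c => (k + f c) ^+ 2) =
  k ^+ 2 + 2 * k * coin_mean N f + coin_mean N (fun c => f c ^+ 2).
Proof.
elim: N f => [|N IH] f; first by rewrite !coin_mean0; ring.
by rewrite !coin_meanS !IH; ring.
Qed.

End CoinMean.

Section Transfer.
Variables (R : realType) (d : measure_display) (T : measurableType d).
Variables (P : probability T R) (p : R).
Variables (N : nat) (eps : 'I_N -> {RV P >-> bool}).
Hypothesis p01 : 0 < p < 1.
Hypothesis eps_bernoulli :
  forall i (A : set bool), distribution P (eps i) A = bernoulli_prob p A.
Hypothesis eps_indep : mutually_independent eps.

Let coins (w : T) : seq bool := [seq eps i w | i <- enum 'I_N].

Let outcome (t : N.-tuple bool) : set T :=
  (\bigcap_(i in [set` [set: 'I_N]%SET]) (eps i @^-1` [set tnth t i]))%classic.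

Lemma outcomeP t w : outcome t w <-> coins w = t.
Proof.
split=> [tw|tw i _ /=].
  rewrite -[RHS]map_tnth_enum; apply: eq_map => i.
  by apply: tw; rewrite /= inE.
by rewrite (tnth_nth false) -tw (nth_map i) ?size_enum_ord ?nth_ord_enum.
Qed.

Lemma measurable_outcome t : measurable (outcome t).
Proof.
apply: fin_bigcap_measurable; first exact: finite_finset.
by move=> i _; apply: measurable_funPTI.
Qed.

Lemma prob_outcome t : P (outcome t) = (\prod_(b <- t) bernoulli_pmf p b)%:E.
Proof.
rewrite /outcome eps_indep // big_tuple.
rewrite -prodEFin; apply: eq_big => [i|i _]; first by rewrite inE.
have := eps_bernoulli i [set tnth t i].
rewrite /distribution /pushforward => ->.
by case/andP: p01 => /ltW p0 /ltW p1; rewrite /bernoulli_prob p0 p1 fsbig_set1.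
Qed.

(** A function of finitely many coins is a finite combination of indicators of
    outcomes, and independence makes the probability of an outcome a product. *)
Lemma expectation_coins (f : seq bool -> R) :
  ('E_P[fun w => f (coins w)] = (coin_mean p N f)%:E)%E.
Proof.
have -> : (fun w => f (coins w)) =
    \sum_(X <- [seq f t \o* (\1_(outcome t) : T -> R) | t : N.-tuple bool]) X.
  apply/funext => w; rewrite fct_sumE big_image /=.
  have sz : size (coins w) == N by rewrite size_map size_enum_ord.
  rewrite (bigD1 (Tuple sz)) //= indicE mem_set ?mul1r; last exact/outcomeP.
  rewrite big1 ?addr0 // => t tw; rewrite indicE memNset ?mul0r //.
  by move/outcomeP => tE; case/eqP: tw; apply: val_inj; rewrite /= tE.
have int1 t : (\1_(outcome t) : T -> R) \in Lfun P 1.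
  apply/Lfun1_integrable; apply: integrable_indic => //.
  exact: measurable_outcome.
rewrite expectation_sum; last first.
  by move=> X /mapP[t _ ->]; exact: Lfun_scale.
rewrite big_image /= -sumEFin; apply: eq_bigr => t _.
rewrite expectationZl // expectation_indic; last exact: measurable_outcome.
by rewrite prob_outcome -EFinM mulrC.
Qed.

(** The centred square is itself a function of the coins, so its integrability
    is covered by [expectation_coins]. *)
Lemma variance_coins (f : seq bool -> R) :
  ('V_P[fun w => f (coins w)] =
   (coin_mean p N (fun c => f c ^+ 2) - coin_mean p N f ^+ 2)%:E)%E.
Proof.
rewrite /variance covariance.unlock expectation_coins /=.
set m := coin_mean p N f.
have := expectation_coins (fun c => (- m + f c) ^+ 2).
rewrite coin_mean_sqr_shift -/m => H.
transitivity ('E_P[fun w => ((- m + f (coins w)) ^+ 2)%R])%E.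
  by congr expectation; apply/funext => w; rewrite /= expr2 addrC.
by rewrite H; congr EFin; ring.
Qed.

End Transfer.

(** * First two moments of the score *)

Section Moments.
Variables (R : realType) (p : R).

Let q : R := 1 - p.

Definition score_mean v fresh close N : R :=
  coin_mean p N (fun c => (score v fresh close c)%:R).

Definition score_mean_sqr v fresh close N : R :=
  coin_mean p N (fun c => (score v fresh close c)%:R ^+ 2).

Lemma score_meanS v fresh close N :
  score_mean v fresh close N.+1 =
    p * ((fresh && (v <= N.+1)%N)%:R + score_mean v true (N.+1 <= v)%N N)
    + q * (1 + score_mean v false close N).
Proof.
rewrite /score_mean coin_meanS /= -!coin_mean_shift.
by congr (_ * _ + _ * _); apply: eq_coin_mean => c sz; rewrite ?sz natrD.
Qed.

Lemma score_mean_sqrS v fresh close N (x : R := (fresh && (v <= N.+1)%N)%:R) :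
  score_mean_sqr v fresh close N.+1 =
    p * (x ^+ 2 + 2 * x * score_mean v true (N.+1 <= v)%N N
         + score_mean_sqr v true (N.+1 <= v)%N N)
    + q * (1 ^+ 2 + 2 * 1 * score_mean v false close N
           + score_mean_sqr v false close N).
Proof.
rewrite /score_mean_sqr coin_meanS /= -!coin_mean_sqr_shift.
by congr (_ * _ + _ * _); apply: eq_coin_mean => c sz; rewrite ?sz natrD.
Qed.

(** Once the strategy bets on n for good, every skipped card and card n score,
    and nothing else does: the score is 1 plus a binomial variable. *)
Lemma score_moments_close v fresh N : (N < v)%N ->
  score_mean v fresh true N = N%:R * q + 1 /\
  score_mean_sqr v fresh true N = N%:R * p * q + (N%:R * q + 1) ^+ 2.
Proof.
elim: N fresh => [|N IH] fresh Nv.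
  by rewrite /score_mean /score_mean_sqr !coin_mean0 /=; split; ring.
have [H1 H2] := IH true (ltnW Nv); have [H1' H2'] := IH false (ltnW Nv).
rewrite score_meanS score_mean_sqrS (ltnW Nv) leqNgt Nv andbF.
by rewrite H1 H2 H1' H2' -natr1 /q /=; split; ring.
Qed.

(** Fewer than [v] coins are left and no card close to n has been shown yet: the
    score is the number C of skipped cards plus the indicator H of the event
    that some card is shown.  As E(C; no card shown) = N q^N, this gives
    E(CH) = N (q - q^N). *)
Lemma score_moments_last v fresh N : (N < v)%N ->
  score_mean v fresh false N = N%:R * q + 1 - q ^+ N /\
  score_mean_sqr v fresh false N =
    N%:R * p * q + N%:R ^+ 2 * q ^+ 2 + 1 - q ^+ N + 2 * N%:R * (q - q ^+ N).
Proof.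
elim: N fresh => [|N IH] fresh Nv.
  by rewrite /score_mean /score_mean_sqr !coin_mean0 /=; split; ring.
have [H1 H2] := score_moments_close true (ltnW Nv).
have [H1' H2'] := IH false (ltnW Nv).
rewrite score_meanS score_mean_sqrS (ltnW Nv) leqNgt Nv andbF.
by rewrite H1 H2 H1' H2' -natr1 exprS /q /=; split; ring.
Qed.

(** With [v] coins left the next card is the last that a guess of the successor
    can hit, so the coin read here is where [fresh] counts for the last time. *)
Lemma score_moments_turn v fresh : (0 < v)%N ->
  score_mean v fresh false v = v%:R * q + 1 - q ^+ v + fresh%:R * p /\
  score_mean_sqr v fresh false v =
    v%:R * p * q + v%:R ^+ 2 * q ^+ 2 + 1 - q ^+ v + 2 * v%:R * (q - q ^+ v)
    + fresh%:R * (3 * p + 2 * (v%:R - 1) * p * q).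
Proof.
case: v => // m _.
have [H1 H2] := score_moments_close true (leqnn m.+1).
have [H1' H2'] := score_moments_last false (leqnn m.+1).
rewrite score_meanS score_mean_sqrS leqnn andbT H1 H2 H1' H2' -natr1 exprS /q.
by split; case: fresh => /=; ring.
Qed.

Lemma score_mean_far v fresh k : (0 < v)%N ->
  score_mean v fresh false (v + k) =
    v%:R * q + 1 - q ^+ v + k%:R * (1 - p * q) + fresh%:R * p.
Proof.
move=> v0; elim: k fresh => [|k IH] fresh.
  rewrite addn0; have [-> _] := score_moments_turn fresh v0.
  by case: fresh => /=; ring.
rewrite addnS score_meanS ltnNge leq_addr leqW ?leq_addr // !IH -natr1 /q.
by case: fresh => /=; ring.
Qed.

(** If the previous card was shown, a shown card scores just as a skipped one;
    if not, it scores nothing.  The two scores thus differ only when the next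
    card is shown, which has probability p, and then they are S + 1 and S, with
    S the score after that card.  This decouples the recursion for the second
    moments. *)
Lemma score_mean_sqr_gap v k : (0 < v)%N ->
  score_mean_sqr v true false (v + k.+1)
    - score_mean_sqr v false false (v + k.+1) =
  p * (1 + 2 * score_mean v true false (v + k)).
Proof.
move=> v0; rewrite addnS !score_mean_sqrS ltnNge leq_addr leqW ?leq_addr //=.
ring.
Qed.

(** The [n] cards are the [v + k.+1] with a coin and card n itself; the bracket
    is the variance.  It starts one coin past [v], because [score_mean_sqr_gap]
    fails with [v] coins left, where showing the next card makes the strategy
    bet on n: hence the separate value of the variance at n = v + 1. *)
Lemma score_mean_sqr_far v k (n : R := (v + k).+2%:R) : (0 < v)%N ->
  score_mean_sqr v true false (v + k.+1) =
    score_mean v true false (v + k.+1) ^+ 2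
    + (p * q * (1 - 3 * p * q) * n - 2 * p * q
       + (3 * v%:R + 5) * p ^+ 2 * q ^+ 2
       + (1 - 2 * v%:R * p + 2 * p ^+ 2) * q ^+ v - q ^+ v ^+ 2).
Proof.
move=> v0; rewrite {}/n; elim: k => [|k IH].
  rewrite score_mean_far // addnS addn0 score_mean_sqrS.
  rewrite ltnNge leqnn leqW ?leqnn //.
  have [-> ->] := score_moments_turn true v0.
  have [-> ->] := score_moments_turn false v0.
  by rewrite -!natr1 /q /=; ring.
have gap := score_mean_sqr_gap k v0.
have -> : score_mean_sqr v true false (v + k.+2) =
    score_mean_sqr v true false (v + k.+1)
    - q * (p * (1 + 2 * score_mean v true false (v + k)))
    + 1 + 2 * (p * score_mean v true false (v + k.+1)
               + q * score_mean v false false (v + k.+1)).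
  rewrite -gap addnS score_mean_sqrS ltnNge leq_addr leqW ?leq_addr //= /q.
  ring.
rewrite IH !score_mean_far // !addnS -!natr1 natrD /q /=.
ring.
Qed.

End Moments.

(** * Mean and variance of the number of correct guesses *)

Theorem theorem1 (R : realType) (d : measure_display) (T : measurableType d)
    (P : probability T R) (p : R) (hp : 0 < p < 1) (n : nat) (hn : (1 <= n)%N)
    (eps : 'I_n.-1 -> {RV P >-> bool})
    (eps_bernoulli :
      forall i (A : set bool), distribution P (eps i) A = bernoulli_prob p A)
    (eps_indep : mutually_independent eps) :
  let q := 1 - p in
  let v := nu p in
  let X := nb_correct p eps in
  ('E_P[X] =
    (if (n <= v)%N then q * n%:R + p
     else (1 - p * q) * n%:R + 2 * p - v.+1%:R * p ^+ 2 - q ^+ v)%:E)%E /\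
  ('V_P[X] =
    (if (n <= v)%N then (n%:R - 1) * p * q
     else if n == v.+1 then
       (v%:R - 1) * p * q + (1 - 2 * (v%:R - 1) * p) * q ^+ v - q ^+ (2 * v)
     else
       p * q * (1 - 3 * p * q) * n%:R - 2 * p * q
       + (3 * v%:R + 5) * p ^+ 2 * q ^+ 2
       + (1 - 2 * v%:R * p + 2 * p ^+ 2) * q ^+ v - q ^+ (2 * v))%:E)%E.
Proof.
move=> q v X.
have v0 : (0 < v)%N := nu_gt0 p.
have -> : X = fun w => (score v true (n <= v)%N
    [seq eps i w | i <- enum 'I_n.-1])%:R :> R.
  by apply/funext => w; rewrite /X /nb_correct correct_guesses_score.
rewrite (expectation_coins hp eps_bernoulli eps_indep
           (fun c => (score v true (n <= v)%N c)%:R)).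
rewrite (variance_coins hp eps_bernoulli eps_indep
           (fun c => (score v true (n <= v)%N c)%:R)).
rewrite -/(score_mean p v true _ _) -/(score_mean_sqr p v true _ _).
(* Past this point nu p is just a positive integer v. *)
rewrite mulnC exprM; clearbody v; clear X.
case: leqP => [n_le|n_gt].
  have nv : (n.-1 < v)%N by rewrite prednK.
  have [-> ->] := score_moments_close p true nv.
  have -> : n%:R = n.-1%:R + 1 :> R by rewrite natr1 prednK.
  by rewrite /q; split; congr EFin; ring.
have [k nE] : exists k, n = (v + k).+1 by exists (n - v.+1)%N; lia.
have -> : n.-1 = (v + k)%N by rewrite nE.
split; congr EFin.
  by rewrite score_mean_far // nE -!natr1 natrD /q /=; ring.
rewrite nE eqSS -[X in _ == X]addn0 eqn_add2l; case: k {nE} => [|k] /=.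
  rewrite addn0; have [-> ->] := score_moments_turn p true v0.
  by rewrite /q /=; ring.
by rewrite score_mean_sqr_far // addnS /q; ring.
Qed.
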